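(* Let $A$ be the $4\times4\times6$ 0-1 pattern whose layers (the $4\times 4$ matrices obtained by fixing the third coordinate to $1,\dots,6$) are $$A_1=\begin{pmatrix}0&0&1&0\\0&0&0&1\\1&0&0&0\\0&1&0&0\end{pmatrix},\quad A_2=\begin{pmatrix}0&0&0&0\\0&0&0&0\\0&0&0&0\\0&0&0&1\end{pmatrix},\quad A_3=\begin{pmatrix}1&0&0&0\\0&0&0&0\\0&0&0&0\\0&0&0&0\end{pmatrix},$$ $$A_4=\begin{pmatrix}0&0&0&0\\0&0&0&0\\0&0&0&0\\1&0&0&0\end{pmatrix},\quad A_5=\begin{pmatrix}0&0&0&1\\0&0&0&0\\0&0&0&0\\0&0&0&0\end{pmatrix},\quad A_6=\begin{pmatrix}0&1&0&0\\1&0&0&0\\0&0&0&1\\0&0&1&0\end{pmatrix}.$$ Then $\operatorname{sat}(6,6,n;A)=O(1)$ as $n\to\infty$.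
   Context: All matrices are 0-1 matrices, here $3$-dimensional. A $3$-dimensional matrix $M$ contains $A$ if some submatrix of $M$ (obtained by selecting a set of indices in each coordinate, keeping the order) can be turned into $A$ by changing some number (possibly zero) of its ones to zeroes. $M$ is $A$-saturated if $M$ does not contain $A$, but changing any $0$ entry of $M$ to a $1$ yields a matrix containing $A$. $\operatorname{sat}(n_1,n_2,n_3;A)$ is the minimum number of ones in an $n_1\times n_2\times n_3$ $A$-saturated matrix. *)

(* Defs.v *)
From mathcomp Require Import all_boot.

Set Implicit Arguments.
Unset Strict Implicit.
Unset Printing Implicit Defensive.

(* Indices are 0-based, and an entry is addressed as M (i, j, k). *)
Notation mat3 n1 n2 n3 := {ffun 'I_n1 * 'I_n2 * 'I_n3 -> bool}.

Definition increasing (k n : nat) (f : {ffun 'I_k -> 'I_n}) : bool :=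
  [forall i : 'I_k, forall j : 'I_k, (i < j) ==> (f i < f j)].

(* Selecting a set of k indices among n, in order, is the same thing as an
   increasing map from 'I_k to 'I_n. *)
Definition submatrix (k1 k2 k3 n1 n2 n3 : nat) (M : mat3 n1 n2 n3)
    (f : {ffun 'I_k1 -> 'I_n1}) (g : {ffun 'I_k2 -> 'I_n2})
    (h : {ffun 'I_k3 -> 'I_n3}) : mat3 k1 k2 k3 :=
  [ffun x => M (f x.1.1, g x.1.2, h x.2)].

(* A is obtained from B by changing some ones to zeroes. *)
Definition dominated (k1 k2 k3 : nat) (A B : mat3 k1 k2 k3) : bool :=
  [forall x, A x ==> B x].

Definition contains (k1 k2 k3 n1 n2 n3 : nat)
    (M : mat3 n1 n2 n3) (A : mat3 k1 k2 k3) : bool :=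
  [exists f : {ffun 'I_k1 -> 'I_n1}, exists g : {ffun 'I_k2 -> 'I_n2},
   exists h : {ffun 'I_k3 -> 'I_n3},
     [&& increasing f, increasing g, increasing h
       & dominated A (submatrix M f g h)]].

Definition set_one (n1 n2 n3 : nat) (M : mat3 n1 n2 n3)
    (p : 'I_n1 * 'I_n2 * 'I_n3) : mat3 n1 n2 n3 :=
  [ffun x => (x == p) || M x].

Definition saturated (k1 k2 k3 n1 n2 n3 : nat)
    (A : mat3 k1 k2 k3) (M : mat3 n1 n2 n3) : bool :=
  ~~ contains M A && [forall p, ~~ M p ==> contains (set_one M p) A].

Definition weight (n1 n2 n3 : nat) (M : mat3 n1 n2 n3) : nat :=
  #|[set p | M p]|.

(* The default n1 * n2 * n3 bounds every weight, so it never falls below the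
   minimum; by [sat_attained] the minimum is attained as soon as A has a one. *)
Definition sat (k1 k2 k3 n1 n2 n3 : nat) (A : mat3 k1 k2 k3) : nat :=
  \big[minn/(n1 * n2 * n3)%N]_(M : mat3 n1 n2 n3 | saturated A M) weight M.

Lemma weight_le n1 n2 n3 (M : mat3 n1 n2 n3) : weight M <= n1 * n2 * n3.
Proof. by rewrite (leq_trans (max_card _)) // !card_prod !card_ord. Qed.

Lemma sat_le k1 k2 k3 n1 n2 n3 (A : mat3 k1 k2 k3) (M : mat3 n1 n2 n3) :
  saturated A M -> sat n1 n2 n3 A <= weight M.
Proof.
move=> sM; rewrite /sat -big_filter.
have: M \in [seq N <- index_enum (mat3 n1 n2 n3) | saturated A N].
  by rewrite mem_filter sM mem_index_enum.
elim: [seq _ <- _ | _] => //= N s IHs.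
rewrite inE big_cons geq_min => /orP[/eqP-> | /IHs->]; first by rewrite leqnn.
by rewrite orbT.
Qed.

Lemma saturated_exists k1 k2 k3 n1 n2 n3 (A : mat3 k1 k2 k3) :
  (exists p, A p) -> exists M : mat3 n1 n2 n3, saturated A M.
Proof.
case=> p Ap; pose Z : mat3 n1 n2 n3 := [ffun => false].
have Z_free : ~~ contains Z A.
  apply/negP=> /existsP[f /existsP[g /existsP[h /and4P[_ _ _]]]].
  by move=> /forallP/(_ p)/implyP/(_ Ap); rewrite !ffunE.
pose M := [arg max_(N > Z | ~~ contains N A) weight N].
have [M_free M_max] : ~~ contains M A /\
    forall N : mat3 n1 n2 n3, ~~ contains N A -> weight N <= weight M.
  by rewrite /M; case: arg_maxnP.
exists M; rewrite /saturated M_free; apply/forallP=> q; apply/implyP=> Mq.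
apply: contraT => /M_max; rewrite leqNgt => /negP[]; apply: proper_card.
apply/properP; split; first by apply/subsetP=> x; rewrite !inE ffunE orbC => ->.
by exists q; rewrite inE ?ffunE ?eqxx.
Qed.

Lemma sat_attained k1 k2 k3 n1 n2 n3 (A : mat3 k1 k2 k3) :
  (exists p, A p) ->
  exists2 M : mat3 n1 n2 n3, saturated A M & weight M = sat n1 n2 n3 A.
Proof.
move=> /(@saturated_exists _ _ _ n1 n2 n3)[M0 sM0].
have: sat n1 n2 n3 A = n1 * n2 * n3 \/
    exists2 M : mat3 n1 n2 n3, saturated A M & weight M = sat n1 n2 n3 A.
  rewrite /sat; elim/big_rec: _ => [|M m sM IHm]; first by left.
  by case: leqP => // _; right; exists M.
case=> // E; exists M0 => //; apply/eqP.
by rewrite eqn_leq sat_le // andbT E weight_le.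
Qed.

(* Entry (i, j, k) is the one in row i and column j of the k-th layer. *)
Definition of_layers (n1 n2 n3 : nat) (L : seq (seq (seq nat))) :
    mat3 n1 n2 n3 :=
  [ffun x : 'I_n1 * 'I_n2 * 'I_n3 =>
    nth 0 (nth [::] (nth [::] L x.2) x.1.1) x.1.2 == 1].

Definition pattern_A : mat3 4 4 6 := of_layers 4 4 6
  [:: [:: [:: 0; 0; 1; 0];
          [:: 0; 0; 0; 1];
          [:: 1; 0; 0; 0];
          [:: 0; 1; 0; 0]];
      [:: [:: 0; 0; 0; 0];
          [:: 0; 0; 0; 0];
          [:: 0; 0; 0; 0];
          [:: 0; 0; 0; 1]];
      [:: [:: 1; 0; 0; 0];
          [:: 0; 0; 0; 0];
          [:: 0; 0; 0; 0];
          [:: 0; 0; 0; 0]];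
      [:: [:: 0; 0; 0; 0];
          [:: 0; 0; 0; 0];
          [:: 0; 0; 0; 0];
          [:: 1; 0; 0; 0]];
      [:: [:: 0; 0; 0; 1];
          [:: 0; 0; 0; 0];
          [:: 0; 0; 0; 0];
          [:: 0; 0; 0; 0]];
      [:: [:: 0; 1; 0; 0];
          [:: 1; 0; 0; 0];
          [:: 0; 0; 0; 1];
          [:: 0; 0; 1; 0]]].

(* Main.v *)
Require Import Defs.
From mathcomp Require Import all_boot.

Set Implicit Arguments.
Unset Strict Implicit.
Unset Printing Implicit Defensive.

(** The layers of the pattern A are numbered 0 to 5 here, and its rows and columns
    0 to 3. The proof exhibits a 6 x 6 x 8 matrix, the witness, that avoids A and
    has this property: insert an empty layer between its layers 3 and 4; then any
    single one placed in that layer creates a copy of A. Any number m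
    of consecutive empty layers can be inserted instead. As no layer of A is
    zero, empty layers cannot take part in a copy of A, so the result still avoids
    A. A maximal matrix above it that avoids A is saturated; it has no one
    in the gap, where a one would create a copy of A, so all its ones lie in the 8
    layers outside the gap, and there are at most 6 * 6 * 8 = 288 of them whatever
    m is ([saturated_above], [gapped_expands], [weight_outside_gap]).

    Where the witness comes from. A lone one in an otherwise empty layer can only
    play the part of layer 1, 2, 3 or 4 of A, the layers with a single one. These
    ones are at the four corners of the 4 x 4 square, so the 6 x 6 layer is cut
    into four 3 x 3 quadrants, one for each value of d = 1, 2, 3, 4. For a given
    d, widen one extreme row and one extreme column of A into three parallel lines
    each, so that the corner one of layer d becomes a whole quadrant, then drop
    layer d. The five remaining layers form the track of d. It is placed
    so that the d layers below the missing one end just below the gap and the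
    others start just above it; it thus occupies layers 4 - d to 8 - d of the
    witness, which is the superposition of the four tracks. A one in the gap
    restores in one track an entry of the layer that had been dropped, hence
    creates a copy of A ([witness_expands]).

    Why the superposition avoids A. Layers 0 and 5 of A are permutation matrices,
    and a layer of the witness contains layer 0 (resp. 5) of A only through the
    widened layer 0 (resp. 5) of some track. There the six lines are grouped as
    3 + 1 + 1 + 1 or 1 + 1 + 1 + 3, and a copy takes one line from each group; so
    the chosen rows include 3, 4, 5 or 0, 1, 2 according to the track, and so do
    the columns, and together they determine d. A copy of A would thus start in
    layer 4 - d and end in layer 8 - d for the same d, which leaves three layers
    for the four middle layers of A. The finite search in [witness_free]
    confirms this. *)

(** * Saturated matrices above a given one *)

Lemma contains_mono (k1 k2 k3 n1 n2 n3 : nat) (A : mat3 k1 k2 k3)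
    (M N : mat3 n1 n2 n3) :
  (forall x, M x -> N x) -> contains M A -> contains N A.
Proof.
move=> MN /existsP[f /existsP[g /existsP[h /and4P[incf incg inch /forallP dom]]]].
apply/existsP; exists f; apply/existsP; exists g; apply/existsP; exists h.
rewrite incf incg inch; apply/forallP=> x; apply/implyP=> Ax.
by move/implyP/(_ Ax): (dom x); rewrite !ffunE => /MN.
Qed.

(** A maximal matrix among those that avoid A and lie above M0 is saturated. *)
Lemma saturated_above (k1 k2 k3 n1 n2 n3 : nat) (A : mat3 k1 k2 k3)
    (M0 : mat3 n1 n2 n3) :
  ~~ contains M0 A ->
  exists2 M : mat3 n1 n2 n3, saturated A M & forall x, M0 x -> M x.
Proof.
move=> M0_free.
pose P (N : mat3 n1 n2 n3) := ~~ contains N A && [forall x, M0 x ==> N x].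
have P0 : P M0 by rewrite /P M0_free; apply/forallP=> x; apply/implyP.
pose M := [arg max_(N > M0 | P N) weight N].
have [PM M_max] : P M /\ forall N, P N -> weight N <= weight M.
  by rewrite /M; case: arg_maxnP.
have /andP[M_free /forallP M0M] := PM.
exists M => [|x]; last exact/implyP.
rewrite /saturated M_free; apply/forallP=> q; apply/implyP=> Mq.
apply: contraT => q_free.
have /M_max : P (set_one M q).
  rewrite /P q_free; apply/forallP=> x; apply/implyP=> M0x.
  by rewrite ffunE (implyP (M0M x)) ?orbT.
rewrite leqNgt => /negP[]; apply: proper_card; apply/properP; split.
  by apply/subsetP=> x; rewrite !inE ffunE orbC => ->.
by exists q; rewrite inE ?ffunE ?eqxx.
Qed.

(** * Containment as a search through a list of layers *)

Notation layer := (seq (seq nat)).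

Definition entry (a : layer) (i j : nat) : bool := nth 0 (nth [::] a i) j == 1.

Definition fits (rs cs : seq nat) (a m : layer) : bool :=
  all (fun i => all (fun j =>
    entry a i j ==> entry m (nth 0 rs i) (nth 0 cs j))
  (iota 0 (size cs))) (iota 0 (size rs)).

Lemma fitsP (rs cs : seq nat) (a m : layer) :
  reflect (forall i j, i < size rs -> j < size cs -> entry a i j ->
             entry m (nth 0 rs i) (nth 0 cs j))
          (fits rs cs a m).
Proof.
apply: (iffP idP) => [H i j ltir ltjc aij | H].
  have /(_ i) := allP H; rewrite mem_iota => /(_ ltir)/allP/(_ j).
  by rewrite mem_iota => /(_ ltjc)/implyP->.
apply/allP=> i; rewrite mem_iota => ltir.
apply/allP=> j; rewrite mem_iota => ltjc.
by apply/implyP; apply: H.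
Qed.

(** The greedy search for a subsequence, as in [subseq] but with the relation e
    in place of equality. Once rows and columns are fixed it decides containment,
    in a time linear in the number of layers. *)
Fixpoint embeds (T U : Type) (e : T -> U -> bool) (s : seq T) (t : seq U) :=
  if t is y :: t' then
    if s is x :: s' then embeds e (if e x y then s' else s) t' else true
  else nilp s.

Lemma embeds_behead (T U : Type) (e : T -> U -> bool) x s t :
  embeds e (x :: s) t -> embeds e s t.
Proof.
elim: t x s => [|y t IHt] x [|z s] //=.
case: (e x y); case: (e z y) => //; try exact: IHt.
by move/IHt/IHt.
Qed.

Lemma embedsP (T : Type) (U : eqType) (e : T -> U -> bool) s (t : seq U) :
  reflect (exists2 u, subseq u t & all2 e s u) (embeds e s t).
Proof.
apply: (iffP idP) => [|[u sub]].
  elim: t s => [|y t IHt] [|x s] //=; try by exists [::].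
  case exy: (e x y) => /IHt[u sub su].
    by exists (y :: u); rewrite /= ?eqxx // exy.
  by exists u => //; apply: subseq_trans sub (subseq_cons _ _).
elim: t s u sub => [|y t IHt] [|x s] [|z u] //=.
case: eqP => [->|_] sub /andP[exy su]; first by rewrite exy; apply: IHt su.
have: embeds e (x :: s) t by apply: IHt sub _; rewrite /= exy.
by case: ifP => // _; apply: embeds_behead.
Qed.

Lemma embeds_subseq (T : Type) (U : eqType) (e : T -> U -> bool) s
    (t1 t2 : seq U) :
  subseq t1 t2 -> embeds e s t1 -> embeds e s t2.
Proof.
move=> sub /embedsP[u /subseq_trans-/(_ _ sub) subu su].
by apply/embedsP; exists u.
Qed.

(** This is how empty layers drop out: none of them matches a nonzero layer of the
    pattern, so inserting them creates no copy of it. *)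
Lemma embeds_skip (T U : Type) (e : T -> U -> bool) y0 m s t1 t2 :
  all (fun x => ~~ e x y0) s ->
  embeds e s (t1 ++ nseq m y0 ++ t2) -> embeds e s (t1 ++ t2).
Proof.
elim: t1 s => [|y t1 IHt] [|x s] //=.
- by move=> _ _; case: t2.
- case/andP=> exy0 _; elim: m => //= m IHm.
  by rewrite (negPf exy0).
case/andP=> exy0 sy0; case: ifP => _; apply: IHt => //=.
by rewrite exy0.
Qed.

Lemma increasing_subseq (k n : nat) (h : {ffun 'I_k -> 'I_n}) :
  increasing h -> exists s : seq nat,
    [/\ size s = k, subseq s (iota 0 n) & forall i : 'I_k, nth 0 s i = h i].
Proof.
move=> /forallP inch; set s := [seq val (h i) | i <- enum 'I_k].
have size_s : size s = k by rewrite size_map size_enum_ord.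
exists s; split=> // [|i]; last first.
  rewrite (nth_map i) ?size_enum_ord //; congr (val (h _)).
  by apply: val_inj; rewrite /= nth_enum_ord.
have sorted_s : sorted ltn s.
  rewrite sorted_map; have := iota_ltn_sorted 0 k.
  rewrite -val_enum_ord sorted_map; apply: sub_sorted => i j /= ltij.
  by move/forallP/(_ j)/implyP: (inch i); apply.
suff -> : s = [seq x <- iota 0 n | x \in s] by apply: filter_subseq.
apply: (irr_sorted_eq ltn_trans ltnn) => //.
  exact/(sorted_filter ltn_trans)/iota_ltn_sorted.
move=> x; rewrite mem_filter mem_iota /= andb_idr // => /mapP[i _ ->].
exact: ltn_ord.
Qed.

Lemma subseq_increasing (k n : nat) (s : seq nat) :
  size s = k -> subseq s (iota 0 n) ->
  exists2 h : {ffun 'I_k -> 'I_n},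
    increasing h & forall i, h i = nth 0 s i :> nat.
Proof.
move=> <- sub.
have lts (i : 'I_(size s)) : nth 0 s i < n.
  by have := mem_subseq sub (mem_nth 0 (ltn_ord i)); rewrite mem_iota.
exists [ffun i => Ordinal (lts i)] => [|i]; last by rewrite ffunE.
apply/forallP=> i; apply/forallP=> j; apply/implyP; rewrite !ffunE /=.
have := subseq_sorted ltn_trans sub (iota_ltn_sorted 0 n).
by move=> srt; apply: (sorted_ltn_nth ltn_trans 0 srt); rewrite inE ltn_ord.
Qed.

Lemma of_layersE (n1 n2 n3 : nat) (L : seq layer) x :
  of_layers n1 n2 n3 L x = entry (nth [::] L x.2) x.1.1 x.1.2.
Proof. by rewrite ffunE. Qed.

(** With [embeds_contains], this turns containment, a statement about increasing
    finite functions, into one about lists that evaluates by computation. *)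
Lemma contains_embeds (k1 k2 n1 n2 : nat) (P L : seq layer) :
  contains (of_layers n1 n2 (size L) L) (of_layers k1 k2 (size P) P) ->
  exists rs cs, [/\ subseq rs (iota 0 n1), size rs = k1,
    subseq cs (iota 0 n2), size cs = k2 & embeds (fits rs cs) P L].
Proof.
case/existsP=> f /existsP[g /existsP[h /and4P[incf incg inch /forallP dom]]].
have [rs [size_rs sub_rs rsE]] := increasing_subseq incf.
have [cs [size_cs sub_cs csE]] := increasing_subseq incg.
have [ts [size_ts sub_ts tsE]] := increasing_subseq inch.
exists rs, cs; split=> //.
apply/embedsP; exists [seq nth [::] L t | t <- ts].
  by rewrite -[X in subseq _ X](mkseq_nth [::]); apply: map_subseq.
rewrite all2E size_map size_ts eqxx /=.
apply/(all_nthP ([::], [::])) => t; rewrite size_zip size_map size_ts minnn => ltt.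
rewrite nth_zip ?size_map //= (nth_map 0) ?size_ts //.
apply/fitsP=> i j; rewrite size_rs size_cs => lti ltj aij.
have := dom (Ordinal lti, Ordinal ltj, Ordinal ltt).
rewrite of_layersE /= aij ffunE of_layersE /=.
by rewrite -(rsE (Ordinal lti)) -(csE (Ordinal ltj)) -(tsE (Ordinal ltt)).
Qed.

Lemma embeds_contains (n1 n2 : nat) (rs cs : seq nat) (P L : seq layer) :
  subseq rs (iota 0 n1) -> subseq cs (iota 0 n2) -> embeds (fits rs cs) P L ->
  contains (of_layers n1 n2 (size L) L)
           (of_layers (size rs) (size cs) (size P) P).
Proof.
move=> /(subseq_increasing erefl)[f incf fE] /(subseq_increasing erefl)[g incg gE].
case/embedsP=> u sub; rewrite all2E => /andP[/eqP szPu /(all_nthP ([::], [::])) fitP].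
have [js subj uE] : exists2 js, subseq js (iota 0 (size L)) &
    u = [seq nth [::] L j | j <- js].
  have /subseqP[b _ ->] := sub; exists (mask b (iota 0 (size L))).
    exact: mask_subseq.
  by rewrite map_mask -[X in mask b X](mkseq_nth [::]).
have szj : size js = size P by rewrite szPu uE size_map.
have [h inch hE] := subseq_increasing szj subj.
apply/existsP; exists f; apply/existsP; exists g; apply/existsP; exists h.
rewrite incf incg inch; apply/forallP=> -[[i j] t].
rewrite of_layersE ffunE of_layersE /= fE gE hE; apply/implyP=> aij.
have := fitP t; rewrite size_zip -szPu minnn nth_zip //= => /(_ (ltn_ord t)).
rewrite uE (nth_map 0) ?szj // => /fitsP; exact.
Qed.

Definition single (n1 n2 i j : nat) : layer :=
  mkseq (fun x => mkseq (fun y => (x == i) && (y == j) : nat) n2) n1.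

Lemma set_one_of_layers (n1 n2 n3 : nat) (L : seq layer)
    (p : 'I_n1 * 'I_n2 * 'I_n3) :
  nth [::] L p.2 = [::] ->
  set_one (of_layers n1 n2 n3 L) p =
  of_layers n1 n2 n3 (set_nth [::] L p.2 (single n1 n2 p.1.1 p.1.2)).
Proof.
case: p => [[i j] k] /= Lk; apply/ffunP=> -[[x y] t].
rewrite !(ffunE, of_layersE) /= nth_set_nth /=.
rewrite !xpair_eqE -!val_eqE /=.
have [->|_] := eqVneq (t : nat) k; last by rewrite andbF.
rewrite Lk /entry !nth_nil andbT orbF !nth_mkseq //.
by case: (_ && _).
Qed.

Lemma nth_gap (T : Type) (x0 : T) (lo hi : seq T) (m k : nat) :
  size lo <= k < size lo + m -> nth x0 (lo ++ nseq m x0 ++ hi) k = x0.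
Proof.
case/andP=> lek ltk; rewrite !nth_cat size_nseq ltnNge lek /=.
by rewrite ltn_subLR // ltk nth_nseq if_same.
Qed.

Lemma subseq_set_gap (T : eqType) (x0 x : T) (lo hi : seq T) (m k : nat) :
  size lo <= k < size lo + m ->
  subseq (lo ++ x :: hi) (set_nth x0 (lo ++ nseq m x0 ++ hi) k x).
Proof.
case/andP=> lek ltk; rewrite set_nthE !size_cat size_nseq addnA ltn_addr //.
apply: cat_subseq.
  by rewrite take_cat ltnNge lek; apply: prefix_subseq.
rewrite /= eqxx drop_cat ltnNge leqW //= drop_cat size_nseq ltn_subLR ?leqW //.
case: ifP => _; first exact: suffix_subseq.
by move: ltk; rewrite -subn_eq0 subnDA => /eqP->; rewrite drop0.
Qed.

(** * The witness *)

Definition pattern_layers : seq layer :=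
  [:: [:: [:: 0; 0; 1; 0]; [:: 0; 0; 0; 1]; [:: 1; 0; 0; 0]; [:: 0; 1; 0; 0]];
      [:: [:: 0; 0; 0; 0]; [:: 0; 0; 0; 0]; [:: 0; 0; 0; 0]; [:: 0; 0; 0; 1]];
      [:: [:: 1; 0; 0; 0]; [:: 0; 0; 0; 0]; [:: 0; 0; 0; 0]; [:: 0; 0; 0; 0]];
      [:: [:: 0; 0; 0; 0]; [:: 0; 0; 0; 0]; [:: 0; 0; 0; 0]; [:: 1; 0; 0; 0]];
      [:: [:: 0; 0; 0; 1]; [:: 0; 0; 0; 0]; [:: 0; 0; 0; 0]; [:: 0; 0; 0; 0]];
      [:: [:: 0; 1; 0; 0]; [:: 1; 0; 0; 0]; [:: 0; 0; 0; 1]; [:: 0; 0; 1; 0]]].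

(** The pull-back of a along two maps of lines, which repeats each row and column
    of a as often as its index occurs in the lists. *)
Definition blowup (rows cols : seq nat) (a : layer) : layer :=
  [seq [seq nth 0 (nth [::] a u) v | v <- cols] | u <- rows].

Definition superpose (s : seq layer) : layer :=
  mkseq (fun i => mkseq (fun j => has (fun a => entry a i j) s : nat) 6) 6.

Definition widen_first := [:: 0; 0; 0; 1; 2; 3].
Definition widen_last := [:: 0; 1; 2; 3; 3; 3].

(** Entry t goes to layer t of the witness, whose gap is between layers 3 and 4.
    After the 4 - d empty layers, the d layers of A before the dropped one end
    at layer 3. *)
Definition track (d : nat) (rows cols : seq nat) : seq layer :=
  let B := map (blowup rows cols) pattern_layers in
  nseq (4 - d) [::] ++ take d B ++ drop d.+1 B ++ nseq d.-1 [::].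

(** The widened corner is the one that holds the only entry of layer d of A:
    (3, 3), (0, 0), (3, 0) and (0, 3) for d = 1, 2, 3, 4. *)
Definition tracks : seq (seq layer) :=
  [:: track 1 widen_last widen_last; track 2 widen_first widen_first;
      track 3 widen_last widen_first; track 4 widen_first widen_last].

Definition witness : seq layer :=
  mkseq (fun t => superpose [seq nth [::] T t | T <- tracks]) 8.

Definition witness_around (s : seq layer) : seq layer :=
  take 4 witness ++ s ++ drop 4 witness.

Fixpoint subseqs (s : seq nat) : seq (seq nat) :=
  if s is x :: s' then map (cons x) (subseqs s') ++ subseqs s' else [:: [::]].

Lemma mem_subseqs s t : subseq t s -> t \in subseqs s.
Proof.
elim: s t => [|x s IHs] [|y t] //=; rewrite mem_cat.
  by move=> _; rewrite IHs ?sub0seq ?orbT.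
case: eqP => [-> /IHs sub|_ /IHs->]; last by rewrite orbT.
by rewrite map_f.
Qed.

Definition four_lines : seq (seq nat) :=
  [seq s <- subseqs (iota 0 6) | size s == 4].

(** The four rows, or columns, of the copy of A created by a one in line i of the
    gap: i stands for the widened group that contains it, and each other group
    has a single line. *)
Definition lines_through (i : nat) : seq nat :=
  if i < 3 then [:: i; 3; 4; 5] else [:: 0; 1; 2; i].

(** A finite check over all choices of four rows and four columns. Its outcome is
    negative because layers 0 and 5 of a copy of A are at least five layers apart,
    while in each track they are four apart. *)
Lemma witness_free (rs cs : seq nat) :
  rs \in four_lines -> cs \in four_lines ->
  all (fun a => ~~ fits rs cs a [::]) pattern_layers &&
  ~~ embeds (fits rs cs) pattern_layers (witness_around [::]).
Proof.
suff /allP free : all (fun rs => all (fun cs =>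
    all (fun a => ~~ fits rs cs a [::]) pattern_layers &&
    ~~ embeds (fits rs cs) pattern_layers (witness_around [::]))
  four_lines) four_lines by move=> /free/allP; apply.
by vm_compute.
Qed.

Lemma witness_expands (i j : 'I_6) :
  embeds (fits (lines_through i) (lines_through j)) pattern_layers
         (witness_around [:: single 6 6 i j]).
Proof.
suff /allP expands : all (fun i => all (fun j =>
    embeds (fits (lines_through i) (lines_through j)) pattern_layers
           (witness_around [:: single 6 6 i j])) (iota 0 6)) (iota 0 6).
  have /expands/allP : (i : nat) \in iota 0 6 by rewrite mem_iota ltn_ord.
  by apply; rewrite mem_iota ltn_ord.
by vm_compute.
Qed.

Definition gapped (m : nat) : mat3 6 6 (m + 8) :=
  of_layers 6 6 (m + 8) (witness_around (nseq m [::])).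

Lemma size_gapped m : size (witness_around (nseq m [::])) = m + 8.
Proof. by rewrite !size_cat size_nseq size_take size_drop size_mkseq /= addnCA. Qed.

Lemma gapped_free (m : nat) : ~~ contains (gapped m) pattern_A.
Proof.
rewrite /gapped -{1 2}size_gapped; apply/negP.
case/(@contains_embeds 4 4 6 6 pattern_layers) => rs [cs [sub_rs size_rs sub_cs size_cs]].
have mem_four s : subseq s (iota 0 6) -> size s = 4 -> s \in four_lines.
  by move=> /mem_subseqs sub size_s; rewrite mem_filter size_s sub.
have /andP[no_fit] :=
  witness_free (mem_four _ sub_rs size_rs) (mem_four _ sub_cs size_cs).
by move=> /negP free /(embeds_skip no_fit).
Qed.

Lemma gapped_expands (m : nat) (p : 'I_6 * 'I_6 * 'I_(m + 8)) :
  4 <= p.2 < 4 + m -> contains (set_one (gapped m) p) pattern_A.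
Proof.
case: p => [[i j] k] /= gap_k.
rewrite set_one_of_layers /=; last exact: (@nth_gap _ _ (take 4 witness)).
set L := set_nth _ _ _ _.
have size_L : size L = m + 8.
  by rewrite size_set_nth size_gapped; apply/maxn_idPr.
have sub_lines (l : 'I_6) : subseq (lines_through l) (iota 0 6).
  by case: l; do 6?[case=> //].
have size_lines l : size (lines_through l) = 4.
  by rewrite /lines_through; case: ifP.
have := @embeds_contains 6 6 _ _ pattern_layers L (sub_lines i) (sub_lines j).
rewrite !size_lines size_L; apply.
apply: embeds_subseq (witness_expands i j).
exact: (@subseq_set_gap _ _ _ (take 4 witness)).
Qed.

(** Outside the gap there are as many positions as in the 6 x 6 x 8 witness. *)
Lemma weight_outside_gap (m : nat) (M : mat3 6 6 (m + 8)) :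
  (forall p : 'I_6 * 'I_6 * 'I_(m + 8), M p -> ~~ (4 <= p.2 < 4 + m)) ->
  weight M <= 288.
Proof.
move=> gap0.
pose g (t : 'I_8) : 'I_(m + 8) :=
  if t < 4 then insubd (rshift m t) (t : nat) else rshift m t.
pose f (x : 'I_6 * 'I_6 * 'I_8) := (x.1, g x.2).
have sub : [set p | M p] \subset [set f x | x : 'I_6 * 'I_6 * 'I_8].
  apply/subsetP=> -[ij k]; rewrite inE => /gap0/= gap_k.
  (* Layers above the gap are shifted down by m. *)
  have [t gt] : exists t, g t = k.
    have ltk := ltn_ord k; case: (ltnP k 4) gap_k => [ltk4 _|le4k].
      exists (inord k); apply: val_inj.
      by rewrite /g inordK ?ltk4 ?val_insubd ?ltk // (leq_trans ltk4).
    rewrite -leqNgt => le_k; exists (inord (k - m)); apply: val_inj.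
    have lemk : m <= k by apply: leq_trans le_k; apply: leq_addl.
    have lt8 : k - m < 8 by rewrite ltn_subLR.
    have ge4 : 4 <= k - m by rewrite leq_subRL // [m + 4]addnC.
    by rewrite /g inordK // ltnNge ge4 /= inordK // subnKC.
  by apply/imsetP; exists (ij, t); rewrite /f ?gt.
rewrite /weight (leq_trans (subset_leq_card sub)) //.
by rewrite (leq_trans (leq_imset_card _ _)) // !card_prod !card_ord.
Qed.

Theorem theorem6p1 :
  exists C N : nat, forall n : nat, N <= n -> sat 6 6 n pattern_A <= C.
Proof.
exists 288, 8 => n le8n; rewrite -(subnK le8n); set m := n - 8.
have [M satM gappedM] := saturated_above (gapped_free m).
apply: leq_trans (sat_le satM) (weight_outside_gap _) => p Mp.
apply/negP=> /gapped_expands gap_copy.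
have /andP[/negP[]] := satM; apply: contains_mono gap_copy => x.
by rewrite ffunE => /orP[/eqP->|/gappedM].
Qed.
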